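(* Let $X$ be a uniformly perfect metric space with more than one point, and let $F \subseteq X$ be non-empty and compact. Then there exists a family $\{\Phi_s\}_{s \in [\dim_{\mathrm H} F, \overline{\dim}_{\mathrm B} F]}$ of admissible functions such that for all $s,t$ with $\dim_{\mathrm H} F \leq s \leq t \leq \overline{\dim}_{\mathrm B} F$ the following three conditions hold: (i) $\overline{\dim}^{\Phi_s} F = s$; (ii) $\underline{\dim}^{\Phi_s} F = \min\{s, \underline{\dim}_{\mathrm B} F\}$; (iii) $\Phi_s \preceq \Phi_t$.
   Context: For a subset $U$ of a metric space, $|U|$ denotes its diameter, and $B(x,r)$ is the open ball. Convention: $\inf\varnothing=\infty$; dimensions take values in $[0,\infty]$. A metric space $X$ is uniformly perfect if there is $c\in(0,1)$ such that $B(x,R)\setminus B(x,cR)\neq\varnothing$ for all $x\in X$ and $0<R<|X|$. $N_\delta(F)$ is the smallest number of open balls of radius $\delta/2$ with centres in $F$ needed to cover $F$; $F$ is totally bounded if $N_\delta(F)<\infty$ for all $\delta>0$. A function $\Phi\colon(0,\Delta)\to\mathbb{R}$ (for some $\Delta>0$) is admissible if it is monotonic, $0<\Phi(\delta)\le\delta$ for all $\delta\in(0,\Delta)$, and $\Phi(\delta)/\delta\to0$ as $\delta\to0^+$. For a non-empty totally bounded $F\subseteq X$ and admissible $\Phi$, the upper $\Phi$-intermediate dimension $\overline{\dim}^\Phi F$ is the infimum of all $s\ge0$ such that for all $\epsilon>0$ there exists $\delta_0\in(0,1]$ (with $(0,\delta_0)$ contained in the domain of $\Phi$) such that for all $\delta\in(0,\delta_0)$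 there is a finite or countable cover $\{U_1,U_2,\dots\}$ of $F$ by subsets of $X$ with $\Phi(\delta)\le|U_i|\le\delta$ for all $i$ and $\sum_i|U_i|^s\le\epsilon$. The lower $\Phi$-intermediate dimension $\underline{\dim}^\Phi F$ is the infimum of all $s\ge0$ such that for all $\epsilon>0$ and $\delta_0\in(0,1]$ there exist $\delta\in(0,\delta_0)$ (in the domain of $\Phi$) and such a cover of $F$ with $\Phi(\delta)\le|U_i|\le\delta$ for all $i$ and $\sum_i|U_i|^s\le\epsilon$. $\dim_{\mathrm H}F$ is the Hausdorff dimension: the infimum of $s\ge0$ such that for all $\epsilon>0$ there is a finite or countable cover $\{U_i\}$ of $F$ with $\sum_i|U_i|^s\le\epsilon$. $\overline{\dim}_{\mathrm B}F$ and $\underline{\dim}_{\mathrm B}F$ are the $\limsup$ and $\liminf$ as $\delta\to0^+$ of $\log N_\delta(F)/(-\log\delta)$. The Assouad dimension $\dim_{\mathrm A}E$ is the infimum of all $a$ for which there exists $C>0$ such that $N_r(B(x,R)\cap E)\le C(R/r)^a$ for all $x\in E$ and $0<r<R$. For admissible $\Phi_1,\Phi_2$, write $\Phi_1\preceq\Phi_2$ if $\overline{\dim}^{\Phi_1}E\le\overline{\dim}^{\Phi_2}E$ and $\underline{\dim}^{\Phi_1}E\le\underline{\dim}^{\Phi_2}E$ for every non-empty totally bounded subset $E$ with $\dim_{\mathrm A}E<\infty$ of every uniformly perfect metric space with more than one point. *)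

(* Defs.v *)
From HB Require Import structures.
From mathcomp Require Import all_boot all_order all_algebra.
From mathcomp Require Import all_classical all_reals all_analysis.

Set Implicit Arguments.
Unset Strict Implicit.
Unset Printing Implicit Defensive.

Import Order.TTheory GRing.Theory Num.Theory.
Import numFieldNormedType.Exports.

Local Open Scope classical_set_scope.
Local Open Scope ring_scope.

(* The point 0 is added so that the empty set has diameter 0, not -oo. *)
Definition diam (R : realType) (X : metricType R) (U : set X) : \bar R :=
  ereal_sup (0%E |` [set (mdist p.1 p.2)%:E | p in U `*` U]).

Definition uniformly_perfect (R : realType) (X : metricType R) : Prop :=
  exists2 c : R, 0 < c < 1 &
    forall (x : X) (r : R), 0 < r -> (r%:E < diam [set: X])%E ->
      ball x r `\` ball x (c * r) !=set0.

Definition more_than_one_point (T : Type) : Prop := exists x y : T, x <> y.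

Definition covering_number (R : realType) (X : metricType R)
    (d : R) (F : set X) : \bar R :=
  ereal_inf [set n%:R%:E | n in [set n : nat |
    exists A : set X,
      [/\ A `<=` F, (A #= `I_n)%card & F `<=` \bigcup_(x in A) ball x (d / 2)]]].

Definition totally_bounded (R : realType) (X : metricType R) (F : set X) :
    Prop :=
  forall d : R, 0 < d -> (covering_number d F < +oo)%E.

Definition box_ratio (R : realType) (X : metricType R) (F : set X) (d : R) :
    \bar R :=
  (lne (covering_number d F) * ((- ln d)^-1)%:E)%E.

Definition upper_box_dim (R : realType) (X : metricType R) (F : set X) :
    \bar R :=
  limf_esup (box_ratio F) (0 : R)^'+.

Definition lower_box_dim (R : realType) (X : metricType R) (F : set X) :
    \bar R :=
  limf_einf (box_ratio F) (0 : R)^'+.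

(* Finite or countable covers are families [U] indexed by a set [D] of natural
   numbers: padding a finite family with empty sets would violate the lower
   bounds on diameters used below. *)
Definition countable_cover (R : realType) (X : metricType R) (F : set X)
    (D : set nat) (U : nat -> set X) : Prop :=
  F `<=` \bigcup_(i in D) U i.

Definition cover_sum (R : realType) (X : metricType R) (s : R)
    (D : set nat) (U : nat -> set X) : \bar R :=
  (\esum_(i in D) (diam (U i) `^ s))%E.

Definition hausdorff_dim (R : realType) (X : metricType R) (F : set X) :
    \bar R :=
  ereal_inf [set s%:E | s in [set s : R | 0 <= s /\
    forall eps : R, 0 < eps -> exists D U,
      countable_cover F D U /\ (cover_sum s D U <= eps%:E)%E]].

Definition assouad_dim (R : realType) (X : metricType R) (E : set X) :
    \bar R :=
  ereal_inf [set a%:E | a in [set a : R |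
    exists2 C : R, 0 < C &
      forall (x : X) (r r' : R), E x -> 0 < r -> r < r' ->
        (covering_number r (ball x r' `&` E) <= (C * (r' / r) `^ a)%:E)%E]].

(* A function (0, Delta) -> R; values of [gauge_fun] outside (0, Delta) are
   never used. *)
Record gauge_function (R : realType) := GaugeFunction {
  gauge_bound : R;
  gauge_fun :> R -> R
}.

Definition admissible (R : realType) (Phi : gauge_function R) : Prop :=
  let I := [set d : R | 0 < d < gauge_bound Phi] in
  [/\ 0 < gauge_bound Phi,
      (forall x y, I x -> I y -> x <= y -> Phi x <= Phi y) \/
      (forall x y, I x -> I y -> x <= y -> Phi y <= Phi x),
      forall d, I d -> 0 < Phi d <= d &
      Phi d / d @[d --> (0 : R)^'+] --> (0 : R)].

Definition admits_cover (R : realType) (X : metricType R)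
    (Phi : gauge_function R) (F : set X) (s eps d : R) : Prop :=
  exists (D : set nat) (U : nat -> set X),
    [/\ countable_cover F D U,
        forall i, D i -> ((Phi d)%:E <= diam (U i) <= d%:E)%E &
        (cover_sum s D U <= eps%:E)%E].

Definition upper_intermediate_dim (R : realType) (X : metricType R)
    (Phi : gauge_function R) (F : set X) : \bar R :=
  ereal_inf [set s%:E | s in [set s : R | 0 <= s /\
    forall eps : R, 0 < eps ->
      exists2 d0 : R, [/\ 0 < d0, d0 <= 1 & d0 <= gauge_bound Phi] &
        forall d : R, 0 < d < d0 -> admits_cover Phi F s eps d]].

Definition lower_intermediate_dim (R : realType) (X : metricType R)
    (Phi : gauge_function R) (F : set X) : \bar R :=
  ereal_inf [set s%:E | s in [set s : R | 0 <= s /\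
    forall eps d0 : R, 0 < eps -> 0 < d0 <= 1 ->
      exists2 d : R, 0 < d < d0 /\ d < gauge_bound Phi &
        admits_cover Phi F s eps d]].

Definition gauge_preceq (R : realType) (Phi1 Phi2 : gauge_function R) : Prop :=
  forall (Y : metricType R) (E : set Y),
    uniformly_perfect Y -> more_than_one_point Y ->
    E !=set0 -> totally_bounded E -> (assouad_dim E < +oo)%E ->
    (upper_intermediate_dim Phi1 E <= upper_intermediate_dim Phi2 E)%E /\
    (lower_intermediate_dim Phi1 E <= lower_intermediate_dim Phi2 E)%E.

(* Main.v *)
From HB Require Import structures.
Require Import Defs.
From mathcomp Require Import all_boot all_order all_algebra finmap.
From mathcomp Require Import all_classical all_reals all_analysis.
From mathcomp Require Import lra ring.

(** For finite [s] let [Phi_s d] be half the supremum of the [x <= d / |log d|]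
for which [F] has a cover by sets of diameter in [[x, d]] with
[sum |U|^(s + d) <= 1]; let [Phi_oo d = d / |log d|].  Compactness and
[dim_H F < s + d] give such covers, so [Phi_s d > 0], and these covers bound the
upper dimension by [s].  Conversely, at an exponent [s' < s] a cover of cost at
most [1] with sizes in [[Phi_s d, d]] could, for small [d], be enlarged by a
constant factor and still have cost at most [1] at exponent [s + d]; this
contradicts the choice of [Phi_s d] unless [Phi_s d] is already comparable to
[d / |log d|].  In that case the sizes lie in a range that is negligible on the
logarithmic scale, so that [s'] bounds the box-counting ratio of [F] near [d].
Hence the upper dimension is at least [s] as long as [s] does not exceed the
upper box dimension, and the lower one is at least the minimum of [s] and the
lower box dimension.  As [Phi_s] is pointwise nondecreasing in [s], the last
condition is immediate. *)

Set Implicit Arguments.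
Unset Strict Implicit.
Unset Printing Implicit Defensive.

Import Order.TTheory GRing.Theory Num.Theory.
Import numFieldNormedType.Exports.

Local Open Scope classical_set_scope.
Local Open Scope ring_scope.

(** * Estimates near zero and the function [psi] *)

Section NearZero.
Variable R : realType.
Implicit Types (d e s p : R) (P : R -> Prop).

Lemma right0_nearP P :
  (\forall d \near (0 : R)^'+, P d) <->
  exists2 e : R, 0 < e & forall d, 0 < d < e -> P d.
Proof.
split=> [[e /= e0 eP]|[e e0 eP]].
  exists e => // d /andP[d0 de]; apply: eP => //=.
  by rewrite sub0r normrN gtr0_norm.
near=> d; apply: eP; apply/andP; split; near: d.
  exact: nbhs_right_gt.
exact: nbhs_right_lt.
Unshelve. all: by end_near. Qed.

Lemma right0_near_lt e : 0 < e -> \forall d \near (0 : R)^'+, 0 < d < e.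
Proof. by move=> e0; apply/right0_nearP; exists e. Qed.

Lemma right0_near_scale k P : 0 < k ->
  (\forall d \near (0 : R)^'+, P d) -> \forall d \near (0 : R)^'+, P (k * d).
Proof.
move=> k0 /right0_nearP[e e0 eP]; apply/right0_nearP.
exists (e / k); first by rewrite divr_gt0.
move=> d /andP[d0 de]; apply: eP.
by rewrite mulr_gt0//= mulrC -ltr_pdivlMr.
Qed.

Lemma right0_near_lnN C : \forall d \near (0 : R)^'+, C <= - ln d.
Proof.
apply/right0_nearP; exists (expR (- C)); first exact: expR_gt0.
move=> d /andP[d0 dC]; rewrite lerNr -[leRHS]expRK ler_ln ?posrE ?expR_gt0//.
exact: ltW.
Qed.

Lemma right0_near_powR p K e : 0 < p -> 0 <= K -> 0 < e ->
  \forall d \near (0 : R)^'+, K * d `^ p <= e.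
Proof.
move=> p0 K0 e0; have K1 : 0 < K + 1 by rewrite ltr_wpDl.
have /cvgr0Pnorm_lt/(_ (e / (K + 1))) := powR_cvg0 p0.
rewrite divr_gt0// => /(_ isT); apply: filterS => d.
rewrite ger0_norm ?powR_ge0// ltr_pdivlMr// => /ltW; apply: le_trans.
by rewrite mulrC ler_wpM2l ?powR_ge0// lerDl.
Qed.

(* Negligible compared with [d], but not on the logarithmic scale that box
   dimensions see. *)
Definition psi d := d / - ln d.

Lemma psi_gt0 d : 0 < d < 1 -> 0 < psi d.
Proof.
by move=> /andP[d0 d1]; rewrite divr_gt0// oppr_gt0 ln_lt0// d0.
Qed.

Lemma lnN_expRN1 d : 0 < d < expR (- 1) -> 1 <= - ln d.
Proof.
move=> /andP[d0 d1]; rewrite lerNr -[leRHS]expRK ler_ln ?posrE ?expR_gt0//.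
exact: ltW.
Qed.

Lemma psi_le d : 0 < d < expR (- 1) -> psi d <= d.
Proof.
move=> de; have /lnN_expRN1 l1 := de; case/andP: de => d0 _.
by rewrite ler_pdivrMr ?(lt_le_trans _ l1)// ler_peMr// ltW.
Qed.

Lemma psi_homo d e : 0 < d -> d <= e -> e < 1 -> psi d <= psi e.
Proof.
move=> d0 de e1; have e0 := lt_le_trans d0 de; have d1 := le_lt_trans de e1.
have ld : 0 < - ln d by rewrite oppr_gt0 ln_lt0// d0.
have le : 0 < - ln e by rewrite oppr_gt0 ln_lt0// e0.
apply: ler_pM => //; rewrite ?invr_ge0 ?(ltW d0) ?(ltW ld)//.
by rewrite lef_pV2// lerN2 ler_ln.
Qed.

Lemma right0_near_psi k : 0 < k -> \forall d \near (0 : R)^'+, psi d <= k * d.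
Proof.
move=> k0; near=> d.
have d0 : 0 < d by near: d; exact: nbhs_right_gt.
have ld : k^-1 <= - ln d by near: d; exact: right0_near_lnN.
have l0 : 0 < - ln d by rewrite (lt_le_trans _ ld)// invr_gt0.
rewrite ler_pdivrMr// -mulrA mulrCA -[leLHS]mulr1 ler_wpM2l ?(ltW d0)//.
by rewrite -ler_pdivrMl// mulr1.
Unshelve. all: by end_near. Qed.

(** The logarithm of the bound on [n] is [s] times [- ln d + ln (- ln d) + ln 4]. The iterated
    logarithm is sublinear in [- ln d], so the gap [s' - s] absorbs it together with the
    constants. *)
Lemma right0_near_log_ratio s s' : 0 <= s -> s < s' ->
  \forall d \near (0 : R)^'+, forall n : R, 1 <= n ->
    n <= (psi d / 4) `^ (- s) -> ln n <= s' * - ln (4 * d).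
Proof.
(* This choice gives [s * eta <= (s' - s) / 2], also for [s = 0]; the other half of the gap pays for
   the constants collected in [C]. *)
move=> s0 ss'; pose eta := (s' - s) / (2 * (s + 1)).
have s1 : 0 < s + 1 by rewrite ltr_wpDl.
have eta0 : 0 < eta by rewrite divr_gt0 ?subr_gt0// mulr_gt0.
pose C := (s' * ln 4 + s * (ln 4 - ln eta)) / ((s' - s) / 2).
near=> d => n n1 nd.
have d0 : 0 < d by near: d; exact: nbhs_right_gt.
have lC : C <= - ln d by near: d; exact: right0_near_lnN.
have l1 : 1 <= - ln d by near: d; exact: right0_near_lnN.
have l0 : 0 < - ln d by exact: lt_le_trans l1.
have n0 : 0 < n by exact: lt_le_trans n1.
have psi0 : 0 < psi d by rewrite divr_gt0.
have : ln n <= ln ((psi d / 4) `^ (- s)).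
  by rewrite ler_ln ?posrE// powR_gt0// divr_gt0.
rewrite ln_powR ln_div ?posrE// ln_div ?posrE// lnM ?posrE//.
move/le_trans; apply.
have lneta : ln (- ln d) <= eta * - ln d - ln eta.
  rewrite lerBrDl -lnM ?posrE// ltW// ln_sublinear// mulr_gt0//.
have {}lC : s' * ln 4 + s * (ln 4 - ln eta) <= - ln d * ((s' - s) / 2).
  by rewrite -ler_pdivrMr// divr_gt0// subr_gt0.
have seta : s * eta <= (s' - s) / 2.
  rewrite /eta mulrA ler_pdivrMr ?mulr_gt0//.
  by nra.
have : s * ln (- ln d) <= s * (eta * - ln d - ln eta) by rewrite ler_wpM2l.
move: (ln (- ln d)) (ln 4) (ln eta) lC l0 seta => a b g.
have -> : ln d = - - ln d by rewrite opprK.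
move: (- ln d) => l; rewrite opprK.
nra.
Unshelve. all: by end_near. Qed.

End NearZero.

(** * Upper and lower limits along a filter *)

Section Limf.
Variables (R : realType) (T : choiceType) (S : filteredType T).
Variables (G : set_system S).
Hypothesis GF : Filter G.
Implicit Types (f : S -> \bar R) (x : \bar R).

Lemma limf_esup_le f x : (\forall t \near G, (f t <= x)%E) ->
  (limf_esup f G <= x)%E.
Proof.
move=> fx; rewrite limf_esupE.
apply: (@le_trans _ _ (ereal_sup (f @` [set t | (f t <= x)%E]))).
  by apply: ereal_inf_lbound; exists [set t | (f t <= x)%E].
by apply: ge_ereal_sup => _ [t /= tx <-].
Qed.

Lemma limf_einf_ge f x : (\forall t \near G, (x <= f t)%E) ->
  (x <= limf_einf f G)%E.
Proof.
move=> fx; rewrite /limf_einf leeNr limf_esup_le//.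
by apply: filterS fx => t; rewrite leeN2.
Qed.

Lemma lt_limf_einf f x : (x < limf_einf f G)%E ->
  \forall t \near G, (x < f t)%E.
Proof.
rewrite /limf_einf limf_esupE lteNr => /ereal_inf_lt[_ [V GV <-] supV].
apply: filterS GV => t Vt; rewrite -lteN2; apply: le_lt_trans supV.
by apply: ereal_sup_ubound; exists t.
Qed.

End Limf.

(** * Diameters and uniform perfectness *)

Section Diameter.
Variables (R : realType) (X : metricType R).
Implicit Types (U : set X) (x y : X) (r : R).

Lemma diam_ge0 U : (0 <= diam U)%E.
Proof. by apply: ereal_sup_ubound; left. Qed.

Lemma mdist_le_diam U x y : U x -> U y -> ((mdist x y)%:E <= diam U)%E.
Proof. by move=> Ux Uy; apply: ereal_sup_ubound; right; exists (x, y). Qed.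

Lemma diam_le U r : 0 <= r ->
  (forall x y, U x -> U y -> mdist x y <= r) -> (diam U <= r%:E)%E.
Proof.
move=> r0 Ur; apply: ge_ereal_sup => _ [->|[[x y] /= [Ux Uy] <-]].
  by rewrite lee_fin.
by rewrite lee_fin Ur.
Qed.

Lemma diam_gt0_nonempty U : (0 < diam U)%E -> U !=set0.
Proof.
move=> U0; apply/set0P/eqP => UE; move: U0; rewrite UE ltNge => /negP; apply.
by apply: diam_le.
Qed.

Lemma diam_ball_le x r : 0 <= r -> (diam (ball x r) <= (2 * r)%:E)%E.
Proof.
move=> r0; apply: diam_le => [|y z]; first by rewrite mulr_ge0.
rewrite !ballEmdist/= => xy xz.
apply: (le_trans (metric_triangle y x z)).
by rewrite metric_sym; lra.
Qed.

(** Besides its centre, the ball contains a point at distance at least [c * r] from it. Radii below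
    the distance of two fixed points are below the diameter of the space, as uniform perfectness
    requires. *)
Lemma uniformly_perfect_diam_ball :
  uniformly_perfect X -> more_than_one_point X ->
  exists c D : R, [/\ 0 < c < 1, 0 < D &
    forall x r, 0 < r < D -> ((c * r)%:E <= diam (ball x r))%E].
Proof.
move=> [c c01 cX] [p [q pq]]; exists c, (mdist p q).
have pq0 : 0 < mdist p q by rewrite mdist_gt0; apply/eqP.
split=> // x r /andP[r0 rD].
have rX : (r%:E < diam [set: X])%E.
  apply: (@lt_le_trans _ _ (mdist p q)%:E); first by rewrite lte_fin.
  exact: mdist_le_diam.
have [y []] := cX x r r0 rX; move=> xy; rewrite ballEmdist/= => /negP.
rewrite -leNgt -lee_fin => /le_trans; apply; apply: mdist_le_diam => //.
by rewrite ballEmdist/= mdistxx.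
Qed.

End Diameter.

(** * Comparison of unordered sums *)

Section Esum.
Variables (R : realType) (T : choiceType).
Implicit Types (I J : set T) (a b : T -> \bar R).

Lemma esum_le_scale I a b (k : R) : 0 <= k -> (forall i, 0 <= b i)%E ->
  (forall i, I i -> a i <= k%:E * b i)%E ->
  (\esum_(i in I) a i <= k%:E * \esum_(i in I) b i)%E.
Proof.
move=> k0 b0 ab; apply: ge_ereal_sup => _ [S [finS SI] <-].
apply: (@le_trans _ _ (\sum_(i \in S) (k%:E * b i))%E).
  by apply: lee_fsum => // i /SI/ab.
by rewrite -ge0_mule_fsumr// lee_wpmul2l// ereal_sup_ubound//; exists S.
Qed.

Lemma subset_esum I J a : I `<=` J ->
  (\esum_(i in I) a i <= \esum_(i in J) a i)%E.
Proof.
move=> IJ; apply: ereal_sup_le => _ [S [finS SI] <-].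
by exists S => //; split=> //; exact: subset_trans IJ.
Qed.

End Esum.

(** * Covers with sizes in a prescribed range *)

Section ScaleCover.
Variables (R : realType) (X : metricType R).
Implicit Types (F U : set X) (a b d e s t : R) (x : X).

(* [admits_cover Phi F s e d] is convertible to [scale_cover F s e (Phi d) d]. *)
Definition scale_cover F s e a b : Prop :=
  exists (D : set nat) (U : nat -> set X),
    [/\ countable_cover F D U,
        forall i, D i -> (a%:E <= diam (U i) <= b%:E)%E &
        (cover_sum s D U <= e%:E)%E].

Lemma diam_between U a b : 0 < a -> (a%:E <= diam U <= b%:E)%E ->
  exists2 u, diam U = u%:E & a <= u <= b.
Proof.
move=> a0; case: (diam U) => [u| |] /andP[] //.

by rewrite !lee_fin => au ub; exists u => //; apply/andP.
Qed.

Lemma scale_cover_weaken F s e e' a a' b b' : e <= e' -> a' <= a -> b <= b' ->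
  scale_cover F s e a b -> scale_cover F s e' a' b'.
Proof.
move=> ee' aa' bb' [D [U [FU Uab Us]]]; exists D, U; split=> //.
  move=> i /Uab /andP[aU Ub]; apply/andP; split.
    by apply: le_trans aU; rewrite lee_fin.
  by apply: le_trans Ub _; rewrite lee_fin.
by apply: le_trans Us _; rewrite lee_fin.
Qed.

(** For sizes [u <= b] one has [u^t <= b^(t - s) * u^s]; this is how raising the exponent makes
    costs small. *)
Lemma scale_cover_exponent F s t e a b : 0 < a -> s <= t ->
  scale_cover F s e a b -> scale_cover F t (b `^ (t - s) * e) a b.
Proof.
move=> a0 st [D [U [FU Uab Us]]]; exists D, U; split=> //.
apply: (@le_trans _ _ ((b `^ (t - s))%:E * cover_sum s D U)%E); last first.
  by rewrite EFinM lee_wpmul2l// lee_fin powR_ge0.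
apply: esum_le_scale => [|i|i /Uab /(diam_between a0)[u -> /andP[au ub]]].
- exact: powR_ge0.
- exact: poweR_ge0.
have u0 : 0 < u by exact: lt_le_trans au.
rewrite !poweR_EFin -EFinM lee_fin -[leLHS](_ : u `^ (t - s) * u `^ s = _).
  rewrite ler_wpM2r ?powR_ge0//.
  apply: ge0_ler_powR; rewrite ?subr_ge0 ?nnegrE ?(ltW u0)//.
  exact: le_trans (ltW u0) ub.
by rewrite -powRD ?subrK// (gt_eqF u0) implybT.
Qed.

(* Small sets are replaced by balls centred in them, whose diameter is bounded
   below by uniform perfectness; large sets are kept, so as not to exceed [b]. *)
Lemma scale_cover_blowup F s e a b c D m :
  0 < c < 1 -> (forall x r, 0 < r < D -> ((c * r)%:E <= diam (ball x r))%E) ->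
  1 <= m -> m / c * (m * a) < D -> 2 * (m / c * (m * a)) <= b ->
  0 <= s -> 0 < a -> 0 <= e ->
  scale_cover F s e a b -> scale_cover F s ((2 * (m / c)) `^ s * e) (m * a) b.
Proof.
move=> /andP[c0 c1] cD m1 maD mab s0 a0 e0 [I [U [FU Uab Us]]].
have m0 : 0 < m by exact: lt_le_trans m1.
have mc : 1 < m / c by rewrite ltr_pdivlMr// mul1r (lt_le_trans c1).
have mc0 : 0 < m / c by exact: lt_trans mc.
have /choice[V VP] : forall i, exists V : set X, I i ->
    [/\ U i `<=` V, ((m * a)%:E <= diam V <= b%:E)%E &
      (diam V `^ s <= ((2 * (m / c)) `^ s)%:E * diam (U i) `^ s)%E].
  move=> i; have [Ii|] := pselect (I i); last by exists set0.
  have /(_ i Ii)/(diam_between a0)[u uE /andP[au ub]] := Uab.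
  have u0 : 0 < u by exact: lt_le_trans au.
  have [mau|uma] := leP (m * a) u.
    exists (U i) => _; split=> //; first by rewrite uE !lee_fin mau.
    rewrite uE poweR_EFin -EFinM lee_fin ler_peMl ?powR_ge0//.
    rewrite -[leLHS](powRr0 (2 * (m / c))) ler_powR//.
    by move: mc; lra.
  have [x Ux] : U i !=set0 by apply: diam_gt0_nonempty; rewrite uE lte_fin.
  (* With this radius the diameter is at least [m * u] by uniform perfectness and at most
     [2 * (m / c) * u], whence the cost factor. *)
  have r0 : 0 < m / c * u by rewrite mulr_gt0.
  have ruma : m / c * u <= m / c * (m * a) by rewrite ler_wpM2l// ltW.
  have le2r : (diam (ball x (m / c * u)) <= (2 * (m / c * u))%:E)%E.
    by apply: diam_ball_le; exact: ltW.
  have ger : ((m * u)%:E <= diam (ball x (m / c * u)))%E.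
    rewrite (_ : m * u = c * (m / c * u)); last by field; rewrite gt_eqF.
    by apply: cD; rewrite r0 (le_lt_trans ruma).
  exists (ball x (m / c * u)) => _; split.
  - move=> y Uy; rewrite ballEmdist/=; apply: (@le_lt_trans _ _ u).
      by rewrite -lee_fin -uE mdist_le_diam.
    by rewrite ltr_pMl.
  - apply/andP; split.
      by apply: le_trans ger; rewrite lee_fin ler_pM2l.
    by apply: le_trans le2r _; rewrite lee_fin (le_trans _ mab)// ler_pM2l.
  have mu0 : 0 < m * u by rewrite mulr_gt0.
  have [v vE /andP[_ vr]] : exists2 v, diam (ball x (m / c * u)) = v%:E &
      m * u <= v <= 2 * (m / c * u).
    by apply: diam_between => //; rewrite ger le2r.
  have v0 : 0 <= v by rewrite -lee_fin -vE diam_ge0.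
  rewrite vE uE !poweR_EFin -EFinM lee_fin -powRM ?(ltW u0)//; last first.
    by rewrite ltW// mulr_gt0.
  by rewrite ge0_ler_powR ?nnegrE// -mulrA ?(le_trans _ vr).
exists I, V; split.
- by move=> x /FU[i Ii Uix]; exists i => //; have [+ _ _] := VP i Ii; apply.
- by move=> i /VP[].
apply: (@le_trans _ _ (((2 * (m / c)) `^ s)%:E * cover_sum s I U)%E); last first.
  by rewrite EFinM lee_wpmul2l// lee_fin powR_ge0.
apply: esum_le_scale => [|i|i /VP[]//]; first exact: powR_ge0.
exact: poweR_ge0.
Qed.

(** Each set contributes at least [a^s] to a sum bounded by 1. The bound holds for every finite
    subfamily, so the family itself is finite. *)
Lemma scale_cover_card F s a b : 0 < a -> 0 <= s -> scale_cover F s 1 a b ->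
  exists (D : set nat) (U : nat -> set X), [/\ countable_cover F D U,
    forall i, D i -> (a%:E <= diam (U i) <= b%:E)%E, finite_set D &
    (#|` fset_set D|)%:R <= a `^ (- s)].
Proof.
move=> a0 s0 [D [U [FU Uab Us]]]; exists D, U.
have as0 : 0 < a `^ s by exact: powR_gt0.
have cardB (B : {fset nat}) : [set` B] `<=` D -> (#|` B|)%:R <= a `^ (- s).
  move=> BD; rewrite powRN -[_^-1]mul1r ler_pdivlMr// -lee_fin.
  apply: le_trans Us; apply: esum_ge; exists [set` B]; first by split.
  rewrite fsbig_finite//= set_fsetK.
  apply: (@le_trans _ _ (\sum_(i <- B) (a `^ s)%:E)%E).
    rewrite sumEFin lee_fin big_const_seq count_predT iter_addr addr0.
    by rewrite mulr_natl.
  rewrite big_seq [leRHS]big_seq; apply: lee_sum => i iB.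
  have /(_ i (BD i iB))/(diam_between a0)[u -> /andP[au _]] := Uab.
  rewrite poweR_EFin lee_fin; apply: ge0_ler_powR; rewrite ?nnegrE//.
    exact: ltW.
  by rewrite ltW// (lt_le_trans a0).
have finD : finite_set D.
  apply: contrapT.
  move=> /(infinite_set_fset (Num.bound (a `^ (- s))))[B BD nB].
  have := archi_boundP (powR_ge0 a (- s)); apply/negP; rewrite -leNgt.
  by apply: le_trans (cardB _ BD); rewrite ler_nat.
by split=> //; apply: cardB; rewrite fset_setK.
Qed.

(** Sets that miss [F] are discarded, and a point of [F] is picked in each of the others: since
    [b < d / 2], the open ball of radius [d / 2] around it contains the set. *)
Lemma scale_cover_covering_number F s a b d : 0 < a -> 0 <= s -> 2 * b < d ->
  scale_cover F s 1 a b ->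
  exists2 n, n%:R <= a `^ (- s) & (covering_number d F <= n%:R%:E)%E.
Proof.
move=> a0 s0 bd /(scale_cover_card a0 s0)[D [U [FU Uab finD leD]]].
have [->|/set0P[x0 Fx0]] := eqVneq F set0.
  exists 0; first exact: powR_ge0.
  apply: ereal_inf_lbound; exists 0 => //; exists set0; split=> //.
  by rewrite II0.
pose D' := [set i | D i /\ F `&` U i !=set0].
pose g i := xget x0 (F `&` U i).
have gP i : D' i -> (F `&` U i) (g i).
  by move=> [_ xFU]; exact: (xgetPex x0 xFU).
have D'D : D' `<=` D by move=> i [].
have finD' : finite_set D' by exact: sub_finite_set finD.
exists #|` fset_set (g @` D')|.
  apply: le_trans leD; rewrite ler_nat fset_set_image//.
  apply: (leq_trans (leq_imfset_card _ _ _)).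
  by apply: fsubset_leq_card; rewrite -fset_set_sub.
apply: ereal_inf_lbound; eexists; last by [].
exists (g @` D'); split.
- by move=> _ [i D'i <-]; have [] := gP _ D'i.
- rewrite -[X in (X #= _)%card]fset_setK; last exact: finite_image.
  exact/card_eq_fsetP.
- move=> x Fx; have [i Di Uix] := FU x Fx.
  have D'i : D' i by split=> //; exists x.
  exists (g i); first by exists i.
  have [_ Ugi] := gP _ D'i.
  rewrite ballEmdist/= -lte_fin.
  apply: le_lt_trans (mdist_le_diam Ugi Uix) _.
  have /andP[_] := Uab i Di; move=> /le_lt_trans; apply.
  by rewrite lte_fin; lra.
Qed.

(** In the converse direction, the balls of a box-counting cover have diameter at most [d] and, by
    uniform perfectness, at least [c * (d / 2)]. *)
Lemma scale_cover_balls F s a d c D (n : nat) :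
  (forall x r, 0 < r < D -> ((c * r)%:E <= diam (ball x r))%E) ->
  0 < a -> 0 <= s -> 0 < d -> d / 2 < D -> a <= c * (d / 2) ->
  (exists A : set X, [/\ A `<=` F, (A #= `I_n)%card &
     F `<=` \bigcup_(x in A) ball x (d / 2)]) ->
  scale_cover F s (n%:R * d `^ s) a d.
Proof.
move=> cD a0 s0 d0 dD ad [A [AF An FA]].
have finA : finite_set A by exists n.
have Bn := card_fset_set An; move: (fset_setK finA) Bn.
set B := fset_set A => BA Bn.
have [->|/set0P[x0 Fx0]] := eqVneq F set0.
  exists set0, (fun=> set0); split=> //.
  by rewrite /cover_sum esum_set0 lee_fin mulr_ge0 ?powR_ge0.
have d20 : 0 < d / 2 by rewrite divr_gt0.
have diamB x : (a%:E <= diam (ball x (d / 2)) <= d%:E)%E.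
  apply/andP; split.
    by apply: le_trans (cD x _ _); rewrite ?d20// lee_fin.
  apply: (le_trans (diam_ball_le x (ltW d20))).
  by rewrite lee_fin mulrCA divff// mulr1.
exists [set i | (i < n)%N], (fun i => ball (nth x0 B i) (d / 2)); split => //.
  move=> x /FA[y Ay yx]; exists (index y B) => /=.
    by rewrite -Bn index_mem; move: Ay; rewrite -BA.
  by rewrite nth_index//; move: Ay; rewrite -BA.
have dpos i : (0 <= diam (ball (nth x0 B i) (d / 2)) `^ s)%E by exact: poweR_ge0.
rewrite /cover_sum.
rewrite esum_fset//
  -fsbig_ord.
apply: (@le_trans _ _ (\sum_(i < n) (d `^ s)%:E)%E).
  apply: lee_sum => i _.
  have [v -> /andP[av vd]] := diam_between a0 (diamB (nth x0 B i)).
  rewrite poweR_EFin lee_fin; apply: ge0_ler_powR; rewrite ?nnegrE// ltW//.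
  exact: lt_le_trans av.
by rewrite sumEFin lee_fin sumr_const card_ord mulr_natl.
Qed.

End ScaleCover.

(** * Compact sets at exponents above the Hausdorff dimension *)

Section Compact.
Variables (R : realType) (X : metricType R) (F : set X).

Lemma compact_finite_subcover : F !=set0 -> compact F -> cover_compact F.
Proof.
move=> [x0 _] cF.
(* A point of [F] serves as the base point that [compact_cover] expects. *)
pose Y : ptopologicalType :=
  HB.pack (X : Type) (Topological.class X) (isPointed.Build X x0).
by have := @compact_cover Y; rewrite predeqE => /(_ F)[/(_ cF)].
Qed.

(** The exponent can be taken positive, so that roots of order [t] make sense: at exponent 0 every
    set costs 1, even one of diameter zero, so a non-empty [F] has no cover of cost 1/2. *)
Lemma hausdorff_dim_lt (s : R) : F !=set0 -> (hausdorff_dim F < s%:E)%E ->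
  exists2 t : R, 0 < t < s & forall eps : R, 0 < eps ->
    exists D U, countable_cover F D U /\ (cover_sum t D U <= eps%:E)%E.
Proof.
move=> [x Fx] /ereal_inf_lt[_ [t [t0 tP] <-]]; rewrite lte_fin => ts.
exists t => //; rewrite ts andbT lt_neqAle t0 andbT eq_sym.
apply/eqP => t00; have [|D [U [FU Ut]]] := tP (2^-1); first by rewrite invr_gt0.
have [i Di _] := FU x Fx.
have : (1 <= cover_sum t D U)%E.
  apply: esum_ge; exists [set i]; first by split=> // j ->.
  by rewrite fsbig_set1 t00 poweRe0.
move=> /le_trans/(_ Ut); rewrite lee_fin; lra.
Qed.

(* Each set of a cover with small sum is swallowed by a slightly larger ball;
   finitely many of these balls suffice, so their diameters are bounded below. *)
Lemma compact_scale_cover (s d c D : R) : F !=set0 -> compact F ->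
  0 < c -> (forall (x : X) r, 0 < r < D -> ((c * r)%:E <= diam (ball x r))%E) ->
  (hausdorff_dim F < s%:E)%E -> 0 < d -> d <= 1 -> d < D ->
  exists2 a, 0 < a & scale_cover F s 1 a d.
Proof.
move=> F0 cF c0 cD /(hausdorff_dim_lt F0)[t /andP[t0 ts] tP] d0 d1 dD.
have [x0 _] := F0.
have p20 : 0 < (2 : R) `^ t by rewrite powR_gt0.
have dt0 : 0 < d `^ t by rewrite powR_gt0.
have dt1 : d `^ t <= 1.
  by rewrite -[leRHS](powRr0 d) ger_powR ?d0// ltW.
(* This value serves twice: it keeps the diameter of each ball at most [d], and the total cost of
   the balls at most [d^t / 2]. *)
pose eps := d `^ t / (4 * 2 `^ t).
have eps0 : 0 < eps by rewrite divr_gt0// mulr_gt0.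
have epsE : 2 `^ t * (eps + eps) = d `^ t / 2.
  by rewrite /eps; field; rewrite gt_eqF.
have [I [U [FU Ut]]] := tP _ eps0.
have Ieps i : I i -> (diam (U i) `^ t <= eps%:E)%E.
  move=> Ii; apply: le_trans Ut; apply: esum_ge; exists [set i].
    by split=> // j ->.
  by rewrite fsbig_set1.
have IE i : I i -> exists2 u, diam (U i) = u%:E & 0 <= u /\ u `^ t <= eps.
  move=> /Ieps; have := diam_ge0 (U i); case: (diam (U i)) => [u| |]//=.
    by rewrite !lee_fin => u0 ut; exists u.
  by rewrite gt_eqF.
(* Summing to at most [eps], these terms make every radius positive, even for a set of diameter
   zero, and larger than the diameter of the set. *)
pose eta i : R := eps / (2 ^ i.+1)%:R.
have eta0 i : 0 < eta i by rewrite divr_gt0// ltr0n expn_gt0.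
have eta_le i : eta i <= eps.
  rewrite ler_pdivrMr ?ltr0n ?expn_gt0// ler_peMr ?(ltW eps0)//.
  by rewrite ler1n expn_gt0.
pose r i := (fine (diam (U i)) `^ t + eta i) `^ t^-1.
pose g i := xget x0 (U i).
have rt i : r i `^ t = fine (diam (U i)) `^ t + eta i.
  by rewrite /r -powRrM mulVf ?gt_eqF// powRr1// addr_ge0 ?powR_ge0// ltW.
have r0 i : 0 < r i by rewrite powR_gt0// ltr_wpDl ?powR_ge0.
have r2d i : I i -> 2 * r i <= d.
  move=> Ii; have [u uE [u0 ut]] := IE i Ii; rewrite leNgt; apply/negP.
  move=> /(gt0_ltr_powR t0); rewrite !nnegrE => /(_ (ltW d0)).
  rewrite mulr_ge0 ?(ltW (r0 i))// => /(_ isT); apply/negP; rewrite -leNgt.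
  rewrite powRM ?(ltW (r0 i))// rt uE /=.
  apply: (@le_trans _ _ (2 `^ t * (eps + eps))).
    by rewrite ler_pM2l// lerD.
  by rewrite epsE ler_pdivrMr// ler_peMr ?ltW// ltr1n.
have Ur i : I i -> U i `<=` (ball (g i) (r i))^°.
  move=> Ii y Uy; have [u uE [u0 ut]] := IE i Ii.
  have Ug : U i (g i) by apply: xgetPex; exists y.
  have ur : u < r i.
    have uE' : u = (u `^ t) `^ t^-1 by rewrite -powRrM divff ?gt_eqF// powRr1.
    rewrite uE' /r gt0_ltr_powR ?invr_gt0 ?nnegrE ?powR_ge0//.
      by rewrite addr_ge0 ?powR_ge0// ltW.
    by rewrite uE /= ltrDl.
  rewrite /interior -nbhs_ballE; exists (r i - u); first by rewrite /= subr_gt0.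
  move=> z; rewrite !ballEmdist/= => yz.
  apply: le_lt_trans (metric_triangle _ y _) _.
  have : mdist (g i) y <= u by rewrite -lee_fin -uE mdist_le_diam.
  lra.
have [||J JI FJ] := @compact_finite_subcover F0 cF nat I
    (fun i => (ball (g i) (r i))^°).
- by move=> i _; exact: open_interior.
- by move=> x /FU[i Ii Uix]; exists i => //; exact: Ur.
have {}JI i : i \in J -> I i by move=> /JI/set_mem.
(* As [eta] decreases, its value at the largest index used bounds all the radii from below. *)
pose N := (\max_(i <- J) i)%N.
pose a := c * (eta N `^ t^-1).
have ar i : i \in J -> a <= c * r i.
  move=> iJ; rewrite ler_pM2l// /r ge0_ler_powR ?nnegrE ?invr_ge0 ?(ltW t0)//.
    exact: ltW.
    by rewrite addr_ge0 ?powR_ge0// ltW.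
  apply: (@le_trans _ _ (eta i)); last by rewrite lerDr powR_ge0.
  rewrite ler_pM2l// lef_pV2 ?posrE ?ltr0n ?expn_gt0// ler_nat leq_exp2l// ltnS.
  by rewrite /N; exact: leq_bigmax_seq.
have a0 : 0 < a by rewrite mulr_gt0// powR_gt0.
have rD i : i \in J -> 0 < r i < D.
  by move=> /JI/r2d; rewrite r0/=; move: (r0 i) dD; lra.
exists a => //.
have : scale_cover F t 1 a d.
  exists [set` J], (fun i => ball (g i) (r i)); split.
  - by move=> x /FJ[i Ji xi]; exists i => //; exact: interior_subset.
  - move=> i Ji; apply/andP; split.
      by apply: le_trans (cD _ _ (rD _ Ji)); rewrite lee_fin ar.
    apply: le_trans (diam_ball_le _ (ltW (r0 i))) _.
    by rewrite lee_fin; exact/r2d/JI.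
  have -> : 1%E = 1%:E :> \bar R by [].
  apply: (@le_trans _ _ ((2 `^ t)%:E * (eps%:E + eps%:E))%E); last first.
    rewrite -EFinD -EFinM epsE lee_fin; lra.
  apply: (@le_trans _ _ ((2 `^ t)%:E *
      \esum_(i in I) (diam (U i) `^ t + (eta i)%:E))%E).
    apply: (@le_trans _ _ ((2 `^ t)%:E *
        \esum_(i in [set` J]) (diam (U i) `^ t + (eta i)%:E))%E); last first.
      by rewrite lee_wpmul2l ?lee_fin ?(ltW p20)//; exact: subset_esum.
    apply: esum_le_scale => [|i|i /= iJ]; first exact: ltW.
      by rewrite adde_ge0 ?poweR_ge0// lee_fin ltW.
    have Ii := JI _ iJ; have [u uE [u0 ut]] := IE i Ii.
    rewrite uE poweR_EFin -EFinD -EFinM (_ : u = fine (diam (U i))) ?uE//.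
    rewrite -[X in fine X]uE -rt -powRM ?(ltW (r0 i))//.
    have r20 : 0 <= 2 * r i by rewrite mulr_ge0// ltW.
    rewrite -poweR_EFin gt0_ler_poweR ?(ltW t0)// ?in_itv/=.
    - by rewrite diam_ge0 leey.
    - by rewrite lee_fin r20 leey.
    - exact: diam_ball_le (ltW (r0 i)).
  rewrite lee_pmul2l// ?lte_fin// esumD//; last 2 first.
    by move=> i _; exact: poweR_ge0.
    by move=> i _; rewrite lee_fin ltW.
  apply: leeD => //.
  rewrite -[X in esum X _]set_mem_set -nneseries_esum; last first.
    by move=> i _; rewrite lee_fin ltW.
  exact: epsilon_trick0 (ltW eps0).
(* Since [d <= 1], passing from [t] up to [s] does not increase the cost. *)
move=> /(scale_cover_exponent a0 (ltW ts)); apply: scale_cover_weaken => //.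
rewrite mulr1 -[leRHS](powRr0 d) ger_powR ?d0// subr_ge0 ltW//.
Qed.

End Compact.

(** * Box-counting ratios *)

Section BoxRatio.
Variables (R : realType) (X : metricType R) (F : set X).
Implicit Types (d s : R).
Hypothesis F0 : F !=set0.

Lemma covering_number_ge1 d : (1 <= covering_number d F)%E.
Proof.
apply: le_ereal_inf_tmp => _ [n [A [_ An FA]] <-].
rewrite lee_fin ler1n lt0n; apply/eqP => n0; have [x /FA[y Ay _]] := F0.
by move: An; rewrite n0 II0 card_eq0 => /eqP A0; rewrite A0 in Ay.
Qed.

Lemma box_ratio_ge0 d : 0 < d < 1 -> (0 <= box_ratio F d)%E.
Proof.
move=> d01; apply: mule_ge0; first by rewrite lne_ge0 covering_number_ge1.
by rewrite lee_fin invr_ge0 oppr_ge0 ltW// ln_lt0.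
Qed.

Lemma box_ratio_lt d s : 0 < d < 1 -> (box_ratio F d < s%:E)%E ->
  exists2 n : nat, n%:R <= d `^ (- s) &
    exists A : set X, [/\ A `<=` F, (A #= `I_n)%card &
      F `<=` \bigcup_(x in A) ball x (d / 2)].
Proof.
move=> d01; have ld : 0 < - ln d by rewrite oppr_gt0 ln_lt0.
case/andP: d01 => d0 _; rewrite /box_ratio => ratio_lt.
have : (covering_number d F < (d `^ (- s))%:E)%E.
  move: ratio_lt (covering_number_ge1 d).
  case: (covering_number d F) => [x| |] // + x1.
    rewrite lee_fin in x1; have x0 : 0 < x by exact: lt_le_trans x1.
    rewrite lne_EFin// -EFinM lte_fin ltr_pdivrMr// => xs.
    rewrite lte_fin -ltr_ln ?posrE ?powR_gt0// ln_powR.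
    by move: xs; rewrite mulrN mulNr.
  by rewrite /= gt0_mulye ?lte_fin ?invr_gt0.
by move=> /ereal_inf_lt[_ [n nP <-]]; rewrite lte_fin => /ltW; exists n.
Qed.

(** At most [(psi d / 4)^(- s)] sets occur. The scale [4 * d] leaves room for balls centred in [F]:
    their radius [2 * d] exceeds every diameter in the cover. *)
Lemma scale_cover_box_ratio s s' : 0 <= s -> s < s' ->
  \forall d \near (0 : R)^'+, scale_cover F s 1 (psi d / 4) d ->
    (box_ratio F (4 * d) <= s'%:E)%E.
Proof.
move=> s0 ss'; near=> d => Fd.
have /andP[d0 d4] : 0 < d < 4^-1 by near: d; exact: right0_near_lt.
have d401 : 0 < 4 * d < 1 by move: d0 d4; lra.
have psi0 : 0 < psi d / 4 by rewrite divr_gt0// psi_gt0//; move: d0 d4; lra.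
have ld : 0 < - ln (4 * d) by rewrite oppr_gt0 ln_lt0.
have d24 : 2 * d < 4 * d by move: d0; lra.
have [n n_le nF] := scale_cover_covering_number psi0 s0 d24 Fd.
have := le_trans (covering_number_ge1 (4 * d)) nF; rewrite lee_fin => n1.
have n0 : 0 < n%:R :> R by exact: lt_le_trans n1.
rewrite /box_ratio.
apply: (@le_trans _ _ ((ln n%:R)%:E * (- ln (4 * d))^-1%:E)%E).
  rewrite lee_pmul2r// ?lte_fin ?invr_gt0// -lne_EFin//.
  rewrite lee_lne ?in_itv/= ?leey ?andbT//.
  by apply: le_trans (covering_number_ge1 _).
rewrite -EFinM lee_fin ler_pdivrMr//.
have : forall m : R, 1 <= m -> m <= (psi d / 4) `^ (- s) ->
    ln m <= s' * - ln (4 * d).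
  by near: d; exact: right0_near_log_ratio.
exact.
Unshelve. all: by end_near. Qed.

End BoxRatio.

(** * Bounds on intermediate dimensions *)

Lemma EFin_between (R : realType) (x y : \bar R) : (x < y)%E ->
  exists z : R, (x < z%:E < y)%E.
Proof.
case: x y => [x| |] [y| |]//.
- rewrite lte_fin => xy; exists ((x + y) / 2); rewrite !lte_fin.
  by apply/andP; split; move: xy; lra.
- by move=> _; exists (x + 1); rewrite lte_fin ltrDl ltr01 ltry.
- by move=> _; exists (y - 1); rewrite ltNyr lte_fin ltrBlDr ltrDl ltr01.
- by move=> _; exists 0; rewrite ltNyr ltry.
Qed.

Section IntermediateDim.
Variables (R : realType) (X : metricType R) (F : set X).
Variables (Phi : gauge_function R).
Hypotheses (F0 : F !=set0) (bound0 : 0 < gauge_bound Phi).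
Implicit Types (d s : R).

(* At exponents below [t] the bound [Phi d] on the sizes is as good as
   [psi d / 4], so that covers of cost at most [1] control box-counting numbers. *)
Definition sharp_gauge (t : \bar R) : Prop :=
  forall s, 0 <= s -> (s%:E < t)%E -> \forall d \near (0 : R)^'+,
    admits_cover Phi F s 1 d -> scale_cover F s 1 (psi d / 4) d.

(** If the dimension were below [t], some exponent [s < t] would have covers at all small scales.
    Sharpness would then bound the box ratio by some [s'] below the upper box dimension. *)
Lemma sharp_gauge_upper_ge t : sharp_gauge t -> (t <= upper_box_dim F)%E ->
  (t <= upper_intermediate_dim Phi F)%E.
Proof.
move=> sharp tF; rewrite leNgt; apply/negP => /ereal_inf_lt[_ [s [s0 sP] <-] st].
have [s' /andP[ss' s'F]] := EFin_between (lt_le_trans st tF).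
move: s'F; apply/negP; rewrite -leNgt; apply: limf_esup_le.
rewrite lte_fin in ss'; have [e [e0 _ _] eP] := sP 1 ltr01.
have : \forall d \near (0 : R)^'+, (box_ratio F (4 * d) <= s'%:E)%E.
  near=> d.
  have : scale_cover F s 1 (psi d / 4) d -> (box_ratio F (4 * d) <= s'%:E)%E.
    by near: d; exact: scale_cover_box_ratio.
  apply; have : admits_cover Phi F s 1 d.
    by apply: eP; near: d; exact: right0_near_lt.
  by near: d; exact: sharp.
have q0 : 0 < (4 : R)^-1 by rewrite invr_gt0.
move=> /(right0_near_scale q0); apply: filterS => d.
by rewrite mulrA divff// mul1r.
Unshelve. all: by end_near. Qed.

(** Below the lower box dimension the ratio exceeds [s'] at every small scale, which by sharpness
    excludes covers of cost 1 at all of them, not just along a sequence. *)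
Lemma sharp_gauge_lower_ge t : sharp_gauge t ->
  (mine t (lower_box_dim F) <= lower_intermediate_dim Phi F)%E.
Proof.
move=> sharp; rewrite leNgt; apply/negP => /ereal_inf_lt[_ [s [s0 sP] <-]].
rewrite lt_min => /andP[st /EFin_between[s' /andP[ss' /lt_limf_einf s'F]]].
rewrite lte_fin in ss'.
have /right0_nearP[e e0 eP] : \forall d \near (0 : R)^'+,
    ~ admits_cover Phi F s 1 d.
  near=> d => Fd.
  have : (s'%:E < box_ratio F (4 * d))%E.
    by near: d; apply: (right0_near_scale _ s'F).
  apply/negP; rewrite -leNgt.
  have : scale_cover F s 1 (psi d / 4) d -> (box_ratio F (4 * d) <= s'%:E)%E.
    by near: d; exact: scale_cover_box_ratio.
  by apply; move: Fd; near: d; exact: sharp.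
have [||d [/andP[d0]]] := sP 1 (Num.min e 1) => //.
  by rewrite lt_min e0 ltr01 ge_min lexx orbT.
by rewrite lt_min => /andP[de _] _; apply: eP; rewrite d0.
Unshelve. all: by end_near. Qed.

(** For [t > s] and [d <= (t - s) / 2], going from [s + d] to [t] raises the exponent by at least
    [(t - s) / 2], so the cost 1 shrinks to at most [d^((t - s) / 2)]. *)
Lemma upper_intermediate_dim_le s : 0 <= s ->
  (\forall d \near (0 : R)^'+, 0 < Phi d) ->
  (\forall d \near (0 : R)^'+, admits_cover Phi F (s + d) 1 d) ->
  (upper_intermediate_dim Phi F <= s%:E)%E.
Proof.
move=> s0 Phi0 PhiF; rewrite leNgt; apply/negP => /EFin_between[t].
move=> /andP[]; rewrite lte_fin => st; apply/negP; rewrite -leNgt.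
apply: ereal_inf_lbound; exists t => //; split; first by rewrite (le_trans s0)// ltW.
move=> eps eps0; pose p := (t - s) / 2.
have p0 : 0 < p by rewrite divr_gt0// subr_gt0.
have /right0_nearP[e e0 eP] : \forall d \near (0 : R)^'+,
    admits_cover Phi F t eps d.
  near=> d.
  have d0 : 0 < d by near: d; exact: nbhs_right_gt.
  have d1 : d <= 1 by near: d; exact: nbhs_right_le.
  have dp : d <= p by near: d; exact: nbhs_right_le.
  have std : s + d <= t by move: dp st; rewrite /p; lra.
  have Pd : 0 < Phi d by near: d.
  have : admits_cover Phi F (s + d) 1 d by near: d.
  move=> /(scale_cover_exponent Pd std); apply: scale_cover_weaken => //.
  rewrite mulr1; apply: (@le_trans _ _ (1 * d `^ p)).
    by rewrite mul1r ger_powR ?d0//; move: dp; rewrite /p; lra.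
  by near: d; exact: right0_near_powR.
exists (Num.min e (Num.min 1 (gauge_bound Phi))).
  by rewrite !lt_min e0 ltr01 bound0 !ge_min !lexx !orbT.
by move=> d; rewrite !lt_min => /and4P[d0 de _ _]; apply: eP; rewrite d0.
Unshelve. all: by end_near. Qed.

Lemma lower_intermediate_dim_le_upper :
  (lower_intermediate_dim Phi F <= upper_intermediate_dim Phi F)%E.
Proof.
apply: le_ereal_inf_tmp => _ [s [s0 sP] <-]; apply: ereal_inf_lbound.
exists s => //; split=> // eps e eps0 /andP[e0 _].
have [e' [e'0 _ e'b] e'P] := sP eps eps0.
have m0 : 0 < Num.min e e' by rewrite lt_min e0.
have := midf_lt m0; rewrite add0r => -[d0]; rewrite lt_min => /andP[de de'].
exists (Num.min e e' / 2); first by rewrite d0 de (lt_le_trans de').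
by apply: e'P; rewrite d0.
Qed.

(** Where the box ratio is below [s], the balls of radius [d / 2] cost at most [d^(t - s)] at
    exponent [t > s], and their diameters are at least [c / 2 * d], hence at least [psi d] for small
    [d]. *)
Lemma lower_intermediate_dim_le_box :
  uniformly_perfect X -> more_than_one_point X ->
  (\forall d \near (0 : R)^'+, 0 < Phi d <= psi d) ->
  (lower_intermediate_dim Phi F <= lower_box_dim F)%E.
Proof.
move=> upX X2 Phi_psi.
have [c [D [/andP[c0 _] D0 cD]]] := uniformly_perfect_diam_ball upX X2.
have box0 : (0%:E <= lower_box_dim F)%E.
  apply: limf_einf_ge; near=> d; apply: box_ratio_ge0 => //.
  by near: d; exact: right0_near_lt.
rewrite leNgt; apply/negP => /EFin_between[t /andP[+ tPhi]].
move=> /EFin_between[s /andP[sF]]; rewrite lte_fin => st.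
have s0 : 0 <= s by rewrite -lee_fin (le_trans box0)// ltW.
have t0 : 0 <= t by rewrite (le_trans s0)// ltW.
move: tPhi; apply/negP; rewrite -leNgt; apply: ereal_inf_lbound.
exists t => //; split=> // eps e eps0 /andP[e0 _].
(* Without a suitable cover below [e], the box ratio would be at least [s] at all small scales. *)
apply: contrapT => noF; move: sF; apply/negP; rewrite -leNgt.
apply: limf_einf_ge; near=> d; rewrite leNgt; apply/negP => ds.
have d01 : 0 < d < 1 by near: d; exact: right0_near_lt.
have /andP[d0 _] := d01.
have /andP[Pd Pdpsi] : 0 < Phi d <= psi d by near: d.
have psid : psi d <= c / 2 * d.
  by near: d; apply: right0_near_psi; exact: divr_gt0.
have dD : d / 2 < D.
  by rewrite ltr_pdivrMr//; near: d; apply: nbhs_right_lt; rewrite mulr_gt0.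
have dpow : 1 * d `^ (t - s) <= eps.
  by near: d; apply: right0_near_powR => //; rewrite subr_gt0.
have [n ns nF] := box_ratio_lt F0 d01 ds.
apply: noF; exists d.
  rewrite d0; split; near: d; exact: nbhs_right_lt.
have : scale_cover F t (n%:R * d `^ t) (Phi d) d.
  by apply: (@scale_cover_balls _ _ F t (Phi d) d c D) => //; lra.
apply: scale_cover_weaken => //; apply: le_trans dpow.
rewrite mul1r addrC powRD; last by rewrite (gt_eqF d0) implybT.
by rewrite ler_wpM2r ?powR_ge0.
Unshelve. all: by end_near. Qed.

End IntermediateDim.

(** A smaller gauge allows more covers, so more exponents compete in both infima. *)
Lemma le_gauge_preceq (R : realType) (Phi Psi : gauge_function R) :
  gauge_bound Phi = gauge_bound Psi ->
  (forall d, 0 < d < gauge_bound Phi -> Phi d <= Psi d) ->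
  gauge_preceq Phi Psi.
Proof.
move=> bE PhiPsi Y E _ _ _ _ _.
have admits s eps d : 0 < d < gauge_bound Phi ->
    admits_cover Psi E s eps d -> admits_cover Phi E s eps d.
  move=> /PhiPsi PPd.
  exact: (@scale_cover_weaken _ _ E s eps eps (Psi d) (Phi d) d d).
split; apply: ereal_inf_le_tmp => _ [s [s0 sP] <-]; exists s => //; split=> //.
  move=> eps /sP[e [e0 e1 eb] eP]; exists e; first by rewrite bE.
  move=> d /[dup] /andP[d0 de] /eP; apply: admits.
  by rewrite d0 bE (lt_le_trans de).
move=> eps e eps0 e0; have [d [/andP[d0 de] db] dE] := sP eps e eps0 e0.
exists d; first by rewrite d0 de bE.
by apply: admits => //; rewrite d0 bE.
Qed.

(** * The gauge attached to a finite exponent *)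

Section CoverGauge.
Variables (R : realType) (X : metricType R) (F : set X) (c D : R).
Implicit Types (d s t x : R).
Hypotheses (F0 : F !=set0) (cF : compact F) (c01 : 0 < c < 1).
Hypothesis cD :
  forall (x : X) r, 0 < r < D -> ((c * r)%:E <= diam (ball x r))%E.
Hypotheses (D0 : 0 < D) (De : D <= expR (- 1)).

Definition cover_scales s d :=
  [set x | 0 < x <= psi d /\ scale_cover F (s + d) 1 x d].

(* Exponent [s + d] instead of [s] makes the case [s = hausdorff_dim F]
   uniform with the others; halving makes the supremum attained. *)
Definition cover_gauge s :=
  GaugeFunction D (fun d => sup (cover_scales s d) / 2).

Let D1 : D < 1. Proof. by rewrite (le_lt_trans De)// expR_lt1 ltrN10. Qed.

Let lt1 d : 0 < d < D -> 0 < d < 1.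
Proof. by move=> /andP[-> dD]; exact: lt_trans D1. Qed.

Let c0 : 0 < c. Proof. by case/andP: c01. Qed.

Lemma cover_scales_nonempty s d : (hausdorff_dim F <= s%:E)%E -> 0 < d < D ->
  cover_scales s d !=set0.
Proof.
move=> Fs dD; have psi0 := psi_gt0 (lt1 dD); case/andP: dD => d0 dD.
have sd : (hausdorff_dim F < (s + d)%:E)%E.
  by apply: le_lt_trans Fs _; rewrite lte_fin ltrDl.
have d1 := ltW (lt_trans dD D1).
have [a a0 aF] := compact_scale_cover F0 cF c0 cD sd d0 d1 dD.
exists (Num.min a (psi d)); split.
  by rewrite lt_min a0 psi0 ge_min lexx orbT.
by apply: scale_cover_weaken aF; rewrite // ge_min lexx.
Qed.

Lemma cover_scales_ubound s d : has_ubound (cover_scales s d).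
Proof. by exists (psi d) => x [/andP[]]. Qed.

Lemma cover_gauge_attained s d : (hausdorff_dim F <= s%:E)%E -> 0 < d < D ->
  0 < cover_gauge s d /\ exists2 x, cover_scales s d x & cover_gauge s d < x.
Proof.
move=> Fs dD; have [x0 x0P] := cover_scales_nonempty Fs dD.
have supP : has_sup (cover_scales s d).
  by split; [exists x0|exact: cover_scales_ubound].
have sup0 : 0 < sup (cover_scales s d).
  have [/andP[x00 _] _] := x0P; apply: lt_le_trans x00 _.
  by apply: ub_le_sup => //; case: supP.
split=> /=; first by rewrite divr_gt0.
have /(sup_adherent)/(_ supP)[x xP] : 0 < sup (cover_scales s d) / 2.
  by rewrite divr_gt0.
by move=> xlt; exists x => //=; move: xlt; lra.
Qed.

Lemma cover_gauge_le_psi s d : (hausdorff_dim F <= s%:E)%E -> 0 < d < D ->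
  0 < cover_gauge s d <= psi d.
Proof.
move=> Fs dD; have [-> [x [/andP[_ xpsi] _] gx]] := cover_gauge_attained Fs dD.
by rewrite ltW// (lt_le_trans gx).
Qed.

Lemma cover_gauge_admits s d : (hausdorff_dim F <= s%:E)%E -> 0 < d < D ->
  admits_cover (cover_gauge s) F (s + d) 1 d.
Proof.
move=> Fs dD; have [_ [x [_ xF] gx]] := cover_gauge_attained Fs dD.
by apply: scale_cover_weaken xF => //; exact: ltW.
Qed.

(** Increasing [s] or [d] relaxes every constraint on the scales, since raising the exponent does
    not increase costs of sets smaller than 1. Monotonicity in [d] gives admissibility, that in [s]
    the comparison of gauges. *)
Lemma cover_gauge_homo s t d e : (hausdorff_dim F <= s%:E)%E ->
  s <= t -> 0 < d -> d <= e -> e < D -> cover_gauge s d <= cover_gauge t e.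
Proof.
move=> Fs st d0 de eD; have dD : 0 < d < D by rewrite d0 (le_lt_trans de).
have d1 := lt1 dD.
rewrite /= ler_pM2r ?invr_gt0//; apply: sup_le_ub.
  exact: cover_scales_nonempty.
move=> x [/andP[x0 xpsi] xF]; apply: ub_le_sup; first exact: cover_scales_ubound.
split; first by rewrite x0 (le_trans xpsi)// psi_homo// (lt_trans eD).
have ste : s + d <= t + e by rewrite lerD.
move: (scale_cover_exponent x0 ste xF); apply: scale_cover_weaken => //.
rewrite mulr1 -[leRHS](powRr0 d) ger_powR ?subr_ge0//.
by case/andP: d1 => _ /ltW ->; rewrite d0.
Qed.

(* If [4 * cover_gauge s d] were still below [psi d], enlarging the sets of a
   cover of cost at most 1 at an exponent below [s] would beat the supremum. *)
Lemma cover_gauge_sharp s : (hausdorff_dim F <= s%:E)%E ->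
  sharp_gauge F (cover_gauge s) s%:E.
Proof.
move=> Fs s' s'0; rewrite lte_fin => s's.
have k0 : 0 < c / 8 by rewrite divr_gt0.
have K1 : 1 <= 2 * (4 / c).
  by rewrite mulrA ler_pdivlMr//; case/andP: c01; lra.
(* Enlarging by the factor 4 costs [(8 / c)^(s + d)]; the passage from [s'] to [s + d] gains at
   least [d^(s - s')], which wins for small [d]. *)
have cost : \forall d \near (0 : R)^'+,
    (2 * (4 / c)) `^ (s + 1) * d `^ (s - s') <= 1.
  by apply: right0_near_powR; rewrite ?subr_gt0 ?powR_ge0.
near=> d => dF.
have dD : 0 < d < D by near: d; exact: right0_near_lt.
have /andP[d0 d1] := lt1 dD.
have [gt0 _] := cover_gauge_attained Fs dD.
have [psi_lt|psi_ge] := ltP (psi d) (4 * cover_gauge s d).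
  by apply: scale_cover_weaken dF => //; move: psi_lt; lra.
(* The gauge is half the positive supremum, so this element would be twice the supremum. *)
suff : cover_scales s d (4 * cover_gauge s d).
  move=> /(ub_le_sup (cover_scales_ubound s d)); move: gt0 => /=; lra.
split; first by rewrite psi_ge mulr_gt0.
have s'sd : s' <= s + d by move: s's d0; lra.
have psid : psi d <= c / 8 * d by near: d; exact: right0_near_psi.
(* The constant [c / 8] is what keeps the diameters of the enlarged balls at most [d]. *)
have small : 4 / c * (4 * cover_gauge s d) <= d / 2.
  apply: (@le_trans _ _ (4 / c * (c / 8 * d))).
    by rewrite ler_pM2l ?divr_gt0// (le_trans psi_ge).
  by rewrite [leLHS](_ : _ = d / 2)//; field; rewrite gt_eqF.
have Fsd := scale_cover_exponent gt0 s'sd dF; rewrite mulr1 in Fsd.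
have le14 : 1 <= 4 :> R by rewrite ler1n.
have ltD : 4 / c * (4 * cover_gauge s d) < D.
  by case/andP: dD => _; move: small d0; lra.
have le_d : 2 * (4 / c * (4 * cover_gauge s d)) <= d by move: small; lra.
have sd0 : 0 <= s + d by exact: le_trans s'sd.
have := scale_cover_blowup c01 cD le14 ltD le_d sd0 gt0 (powR_ge0 _ _) Fsd.
apply: scale_cover_weaken => //.
apply: (@le_trans _ _ ((2 * (4 / c)) `^ (s + 1) * d `^ (s - s'))).
  apply: ler_pM; rewrite ?powR_ge0//.
    by rewrite ler_powR// lerD2l ltW.
  by rewrite ger_powR ?d0 ?(ltW d1)//; move: d0; lra.
by near: d.
Unshelve. all: by end_near. Qed.

End CoverGauge.

(** * Admissibility and assembly of the family *)

Lemma le_psi_admissible (R : realType) (Phi : gauge_function R) :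
  0 < gauge_bound Phi <= expR (- 1) ->
  (forall d, 0 < d < gauge_bound Phi -> 0 < Phi d <= psi d) ->
  (forall d e, 0 < d -> d <= e -> e < gauge_bound Phi -> Phi d <= Phi e) ->
  admissible Phi.
Proof.
move=> /andP[b0 be] Phi_psi homo; split=> //.
- by left=> d e /andP[d0 _] /andP[_ eb] de; exact: homo.
- move=> d db; have /andP[-> Pd] := Phi_psi d db; apply: le_trans Pd _.
  by apply: psi_le; case/andP: db => -> /lt_le_trans; apply.
apply/cvgr0Pnorm_le => k k0; near=> d.
have db : 0 < d < gauge_bound Phi by near: d; exact: right0_near_lt.
have /andP[P0 Ppsi] := Phi_psi d db; have /andP[d0 _] := db.
rewrite ger0_norm ?divr_ge0 ?(ltW P0) ?(ltW d0)// ler_pdivrMr//.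
apply: le_trans Ppsi _.
by near: d; exact: right0_near_psi.
Unshelve. all: by end_near. Qed.

Lemma hausdorff_dim_ge0 (R : realType) (X : metricType R) (F : set X) :
  (0 <= hausdorff_dim F)%E.
Proof. by apply: le_ereal_inf_tmp => _ [s [s0 _] <-]; rewrite lee_fin. Qed.

Local Open Scope ereal_scope.

Theorem theorem6p1 (R : realType) (X : metricType R) (F : set X) :
  uniformly_perfect X -> more_than_one_point X -> F !=set0 -> compact F ->
  exists Phi : \bar R -> gauge_function R,
    (forall s : \bar R,
      hausdorff_dim F <= s -> s <= upper_box_dim F -> admissible (Phi s)) /\
    (forall s t : \bar R,
      hausdorff_dim F <= s -> s <= t -> t <= upper_box_dim F ->
      [/\ upper_intermediate_dim (Phi s) F = s,
          lower_intermediate_dim (Phi s) F = mine s (lower_box_dim F) &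
          gauge_preceq (Phi s) (Phi t)]).
Proof.
move=> upX X2 F0 cF.
have [c [D' [c01 D'0 cD']]] := uniformly_perfect_diam_ball upX X2.
(* Below [expR (- 1)] one has [psi d <= d]; below [D'] balls have the diameters guaranteed by
   uniform perfectness. *)
pose D : R := Num.min (expR (- 1)) D'.
have D0 : (0 < D)%R by rewrite lt_min expR_gt0.
have De : (D <= expR (- 1))%R by rewrite ge_min lexx.
have cD (x : X) r : (0 < r < D)%R -> (c * r)%:E <= diam (ball x r).
  by rewrite lt_min => /and3P[r0 _ rD']; apply: cD'; rewrite r0.
have D1 : (D < 1)%R by rewrite (le_lt_trans De)// expR_lt1 ltrN10.
(* An infinite index occurs when the upper box dimension is infinite; [psi] then dominates all the
   other gauges. The value at [-oo] is a default, outside the range of indices. *)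
pose Phi (s : \bar R) :=
  if s is r%:E then cover_gauge F D r else GaugeFunction D (@psi R).
have PhiD s : gauge_bound (Phi s) = D by case: s.
have Phi_psi s d : hausdorff_dim F <= s -> (0 < d < D)%R ->
    (0 < Phi s d <= psi d)%R.
  move=> Fs dD; case: s Fs => [s| |] Fs /=.
    exact: (cover_gauge_le_psi F0 cF c01 cD De Fs dD).
    rewrite psi_gt0 ?lexx//; case/andP: dD => -> /lt_trans; exact.
  by have := le_trans (hausdorff_dim_ge0 F) Fs.
have Phi_homo s t d e : hausdorff_dim F <= s -> s <= t ->
    (0 < d)%R -> (d <= e)%R -> (e < D)%R -> (Phi s d <= Phi t e)%R.
  move=> Fs st d0 de eD.
  have psi_le : (Phi s d <= psi e)%R.
    have dD : (0 < d < D)%R by rewrite d0 (le_lt_trans de).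
    have /andP[_ /le_trans] := Phi_psi s d Fs dD; apply.
    by rewrite psi_homo// (lt_trans eD).
  case: t st => [t| |] // st.
  case: s Fs psi_le st => [s| |] // Fs _ st.
    apply: (cover_gauge_homo F0 cF c01 cD De Fs) => //.
  by move: (le_trans (hausdorff_dim_ge0 F) Fs).
have Phi_sharp s : hausdorff_dim F <= s -> sharp_gauge F (Phi s) s.
  case: s => [s| |] Fs; first exact: (cover_gauge_sharp F0 cF c01 cD).
    (* Here the gauge is [psi] itself, which exceeds [psi d / 4]. *)
    move=> s' _ _; near=> d => /=; apply: scale_cover_weaken => //=.
    have : (0 < psi d)%R by apply: psi_gt0; near: d; exact: right0_near_lt.
    by move: (psi d) => x; lra.
  by move: (le_trans (hausdorff_dim_ge0 F) Fs).
exists Phi; split=> [s Fs _|s t Fs st tF].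
  apply: le_psi_admissible; rewrite PhiD ?D0//.
    by move=> d; exact: Phi_psi.
  by move=> d e; exact: Phi_homo.
have bound0 : (0 < gauge_bound (Phi s))%R by rewrite PhiD.
have Phi0 : \forall d \near (0 : R)^'+, (0 < Phi s d <= psi d)%R.
  by near=> d; apply: Phi_psi => //; near: d; exact: right0_near_lt.
have upper_le : upper_intermediate_dim (Phi s) F <= s.
  case: s Fs st bound0 Phi0 => [s| |] Fs st bound0 Phi0; last 2 first.
  - exact: leey.
  - by move: (le_trans (hausdorff_dim_ge0 F) Fs).
  apply: upper_intermediate_dim_le => //.
  - by rewrite -lee_fin (le_trans (hausdorff_dim_ge0 F)).
  - by apply: filterS Phi0 => d /andP[].
  - near=> d; apply: (cover_gauge_admits F0 cF c01 cD) => //.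
    by near: d; exact: right0_near_lt.
have upperE : upper_intermediate_dim (Phi s) F = s.
  apply/le_anti; rewrite upper_le/= sharp_gauge_upper_ge//.
    exact: Phi_sharp.
  exact: le_trans tF.
split=> //.
  apply/le_anti/andP; split; last first.
    by apply: sharp_gauge_lower_ge => //; exact: Phi_sharp.
  rewrite le_min; apply/andP; split.
    by apply: le_trans upper_le; exact: lower_intermediate_dim_le_upper.
  exact: lower_intermediate_dim_le_box.
apply: le_gauge_preceq; first by rewrite !PhiD.
by move=> d; rewrite PhiD => /andP[d0 dD]; exact: Phi_homo.
Unshelve. all: by end_near. Qed.
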